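(* Every CS set is a stratified space.
   Context: A filtered space is a topological space $X$ with a filtration by closed subspaces $X_0\subseteq X_1\subseteq\dots\subseteq X_n=X$ with $X_n\setminus X_{n-1}\neq\emptyset$ ($n$ is the formal dimension; $X_{-1}=\emptyset$). The strata are the non-empty connected components of the spaces $X_i\setminus X_{i-1}$. A stratified space is a filtered space such that any two strata $S,S'$ with $S\cap\overline{S'}\ne\emptyset$ satisfy $S\subset\overline{S'}$. For a filtered space $L$, the open cone $\mathring cL=L\times[0,1[/L\times\{0\}$, with cone point $\vartheta$, has the conic filtration $(\mathring cL)_i=\mathring c(L_{i-1})$, with $\mathring c\emptyset=\{\vartheta\}$. A CS set of dimension $n$ is a filtered space $\emptyset\subset X_0\subseteq X_1\subseteq\dots\subseteq X_{n-1}\subsetneq X_n=X$ such that each $X_i\setminus X_{i-1}$ is empty or an $i$-dimensional metrizable topological manifold, and for each $x\in X_i\setminus X_{i-1}$, $i\ne n$, there exist: an open neighbourhood $V$ of $x$ in $X$ with the induced filtration; an open neighbourhood $U$ of $x$ in $X_i\setminus X_{i-1}$; a compact filtered space $L$ of formal dimension $n-i-1$, whose cone carries the conic filtration; and a homeomorphism $\varphi\colon U\times\mathring cL\to V$ such that $\varphi(u,\vartheta)=u$ for all $u\in U$ and $\varphi(U\times\mathring cL_j)=V\cap X_{i+j+1}$ for all $j\in\{0,\dots,n-i-1\}$. *)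

(* Defs.v *)
From HB Require Import structures.
From mathcomp Require Import all_boot all_order all_algebra generic_quotient.
From mathcomp Require Import all_classical all_reals topology metric_structure.
From mathcomp Require Import normedtype.
Import Order.TTheory GRing.Theory Num.Theory numFieldNormedType.Exports.

Set Implicit Arguments.
Unset Strict Implicit.
Unset Printing Implicit Defensive.

Local Open Scope classical_set_scope.
Local Open Scope ring_scope.
Local Open Scope quotient_scope.

(* A set [A : set T] used as a type is the subspace [set_type A], with the
   initial topology of the inclusion [set_val]. *)

Definition homeomorphism (S T : topologicalType) (f : S -> T) : Prop :=
  continuous f /\
  exists g : T -> S, [/\ cancel f g, cancel g f & continuous g].

Definition homeomorphic (S T : topologicalType) : Prop :=
  exists f : S -> T, homeomorphism f.

Definition metrizable (R : realType) (T : topologicalType) : Prop :=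
  exists M : metricType R, homeomorphic T M.

Definition locally_euclidean (R : realType) (d : nat) (T : topologicalType) :
    Prop :=
  forall x : T, exists (U : set T) (O : set 'rV[R]_d),
    [/\ open_nbhs x U, open O & homeomorphic U O].

Definition metrizable_manifold (R : realType) (d : nat) (T : topologicalType) :
    Prop :=
  metrizable R T /\ locally_euclidean R d T.

(* A filtration of formal dimension [n] is a family [X : nat -> set T] of which
   only the values [X 0], ..., [X n] matter; [skel_pred X i] is [X_{i-1}], with
   [X_{-1}] empty. *)
Definition skel_pred (T : Type) (X : nat -> set T) (i : nat) : set T :=
  if i is j.+1 then X j else set0.

Definition layer (T : Type) (X : nat -> set T) (i : nat) : set T :=
  X i `\` skel_pred X i.

Definition filtered_space (n : nat) (T : topologicalType) (X : nat -> set T) :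
    Prop :=
  [/\ forall i, (i <= n)%N -> closed (X i),
      forall i j, (i <= j)%N -> (j <= n)%N -> X i `<=` X j,
      X n = setT &
      layer X n !=set0].

Definition stratum (n : nat) (T : topologicalType) (X : nat -> set T)
    (S : set T) : Prop :=
  exists i x, [/\ (i <= n)%N, layer X i x &
                  S = connected_component (layer X i) x].

Definition stratified_space (n : nat) (T : topologicalType)
    (X : nat -> set T) : Prop :=
  filtered_space n X /\
  forall S S' : set T, stratum n X S -> stratum n X S' ->
    S `&` closure S' !=set0 -> S `<=` closure S'.

Section OpenCone.
Context {R : realType} {L : topologicalType}.

Local Notation cylinder := (L * (`[0%R, 1%R[%classic : set R))%type.

Definition cone_rel : rel cylinder := fun p q =>
  (p == q) || ((set_val p.2 == 0 :> R) && (set_val q.2 == 0 :> R)).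

Lemma cone_rel_refl : reflexive cone_rel.
Proof. by move=> p; rewrite /cone_rel eqxx. Qed.

Lemma cone_rel_sym : symmetric cone_rel.
Proof. by move=> p q; rewrite /cone_rel eq_sym andbC. Qed.

Lemma cone_rel_trans : transitive cone_rel.
Proof.
move=> q p r /orP[/eqP->//|/andP[p0 q0]] /orP[/eqP<-|/andP[_ r0]];
  by rewrite /cone_rel p0 ?q0 ?r0 orbT.
Qed.

Canonical cone_equiv_rel :=
  EquivRel cone_rel cone_rel_refl cone_rel_sym cone_rel_trans.

Definition open_cone : Type := {eq_quot cone_equiv_rel}.

HB.instance Definition _ :=
  Topological.copy open_cone (quotient_topology open_cone).
HB.instance Definition _ := Quotient.on open_cone.

(* The cone point, as a subset of the cone: a singleton as soon as [L] is
   nonempty, which holds for every filtered space. *)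
Definition cone_point : set open_cone :=
  [set c | exists p : cylinder, set_val p.2 = 0 :> R /\ c = \pi_open_cone p].

Lemma cone_point_unique (c c' : open_cone) :
  cone_point c -> cone_point c' -> c = c'.
Proof.
move=> [p [p0 ->]] [q [q0 ->]]; apply/eqmodP.
by apply/orP; right; rewrite p0 q0 eqxx.
Qed.

Lemma cone_point_nonempty (l : L) : cone_point !=set0.
Proof.
have I0 : (`[0, 1[%classic : set R) 0 by rewrite /= in_itv /= lexx ltr01.
by exists (\pi_open_cone (l, SigSub (mem_set I0))), (l, SigSub (mem_set I0)).
Qed.

(* The cone on a subset [A] of [L]; for [A] empty it is the cone point. *)
Definition subcone (A : set L) : set open_cone :=
  cone_point `|` [set c | exists p : cylinder, A p.1 /\ c = \pi_open_cone p].

Definition conic_filtration (F : nat -> set L) (i : nat) : set open_cone :=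
  subcone (skel_pred F i).

End OpenCone.
Arguments open_cone : clear implicits.

Definition conic_chart (R : realType) (n i : nat) (T : topologicalType)
    (X : nat -> set T) (x : T) : Prop :=
  exists (V U : set T) (L : topologicalType) (F : nat -> set L)
         (phi : (U * open_cone R L)%type -> V),
  [/\ open_nbhs x V,
      U x /\ (exists2 O, open O & U = layer X i `&` O),
      compact [set: L] /\ filtered_space (n - i.+1) F,
      homeomorphism phi &
      (forall (u : U) (c : open_cone R L),
         cone_point c -> set_val (phi (u, c)) = set_val u) /\
      (* the cone on [F j] is the step [j + 1] of the conic filtration *)
      (forall j, (j <= n - i.+1)%N ->
         set_val @` (phi @` (setT `*` conic_filtration F j.+1)) =
         V `&` X (i + j + 1)%N)].

Definition CS_set (R : realType) (n : nat) (T : topologicalType)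
    (X : nat -> set T) : Prop :=
  [/\ filtered_space n X,
      forall i, (i <= n)%N ->
        layer X i = set0 \/ metrizable_manifold R i (layer X i) &
      forall i x, (i < n)%N -> layer X i x -> conic_chart R n i X x].

(* Main.v *)
(* For strata S and S' meeting as in the frontier condition, S `&` closure S'
   is closed in S, and S is connected, so it suffices that it is open in S.
   If dim S' < dim S the two cannot meet, and if dim S' = dim S then S = S'.
   Otherwise take a conic chart at a point of S `&` closure S' and a small
   product of a connected open piece of the layer with a collar of the cone
   point. S' meets this product at some phi (u, [l, t]) with t > 0; all
   phi (u', [l, s]) with s > 0 in the product lie in the same layer, hence in
   S', and letting s tend to 0 puts every nearby u' in closure S'. *)
Require Import Defs.
From mathcomp Require Import all_boot all_order all_algebra generic_quotient.
From mathcomp Require Import all_classical all_reals topology normedtype.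
From mathcomp Require Import zify.
Import Order.TTheory GRing.Theory Num.Theory numFieldNormedType.Exports.

Set Implicit Arguments.
Unset Strict Implicit.
Unset Printing Implicit Defensive.

Local Open Scope classical_set_scope.
Local Open Scope ring_scope.
Local Open Scope quotient_scope.

(** * Subspaces and connectedness *)

Section Subsets.
Context {T : topologicalType}.

Lemma nbhs_set_typeP (A : set T) (x : A) (B : set A) :
  nbhs x B <-> exists2 N, nbhs (set_val x) N & set_val @^-1` N `<=` B.
Proof.
split=> [[_ [[N oN <-] Nx] NB]|[N Nx NB]]; last first.
  by apply: filterS NB _; exact: (@initial_continuous A T set_val).
exists N => //.
by apply: open_nbhs_nbhs; split.
Qed.

Lemma nbhs_image_open (A : set T) (x : A) (B : set A) :
  open A -> nbhs x B -> nbhs (set_val x) (set_val @` B).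
Proof.
move=> oA /nbhs_set_typeP[N Nx NB].
have Ax : nbhs (set_val x) A by apply: open_nbhs_nbhs; split=> //; exact: set_valP.
apply: filterS (filterI Nx Ax) => y [Ny Ay].
by exists (SigSub (mem_set Ay)) => //; exact: NB.
Qed.

Lemma connected_set_type (A : set T) (B : set A) :
  connected (set_val @` B) -> connected B.
Proof.
move=> cB C [c Cc] [D [D' oD' <-] CD] [E cE CE].
have [E' oE' EE'] : open (~` E) by exact: closed_openC.
have valI : injective (@set_val _ A) by exact: val_inj.
suff BC : set_val @` C = set_val @` B.
  apply/seteqP; split=> x xC; have := imageP set_val xC.
    by rewrite BC => -[y By /valI <-].
  by rewrite -BC => -[y By /valI <-].
apply: cB.
- by exists (set_val c); exact: imageP.
- exists D' => //; apply/seteqP; split=> [_ [x + <-]|_ [[x Bx <-] Dx]].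
    by rewrite CD => -[Bx Dx]; split=> //; exact: imageP.
  by apply: imageP; rewrite CD.
- exists (~` E'); first exact: open_closedC.
  apply/seteqP; split=> [_ [x + <-]|_ [[x Bx <-] Ex]].
    rewrite CE => -[Bx Ex]; split; first exact: imageP.
    by move=> E'x; have : (~` E) x by rewrite -EE'.
  apply: imageP; rewrite CE; split=> //; apply: contrapT => nEx.
  by apply: Ex; have : (~` E) x by []; rewrite -EE'.
Qed.

(** A nonempty relatively clopen [U] in [B] meets [A] by density and so contains [A]; being
    relatively closed, it then contains all of [B]. *)
Lemma connected_between (A B : set T) :
  connected A -> A `<=` B -> B `<=` closure A -> connected B.
Proof.
move=> cA AB BA U [u Uu] [C oC UC] [D cD UD].
suff AU : A `<=` U.
  apply/seteqP; split=> [w|w Bw]; first by rewrite UC => -[].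
  rewrite UD; split=> //; rewrite (closure_id D).1 //.
  by apply: closureS (BA _ Bw) => a /AU; rewrite UD => -[].
suff <- : A `&` U = A by move=> w [].
apply: cA.
- move: Uu; rewrite UC => -[/BA clu Cu].
  have [a [Aa Ca]] := clu _ (open_nbhs_nbhs (conj oC Cu)).
  by exists a; split=> //; split=> //; exact: AB.
- by exists C => //; rewrite UC setIA (setIidl AB).
- by exists D => //; rewrite UD setIA (setIidl AB).
Qed.

End Subsets.

(** * Slices of products and local connectedness of manifolds *)

Lemma continuous_pairl (S T : topologicalType) (t : T) :
  continuous (fun s : S => (s, t)).
Proof.
by move=> s A [[B C] [/= Bs Ct] BCA]; apply: filterS Bs => s' Bs'; apply: BCA;
  split=> //=; exact: nbhs_singleton.
Qed.

Lemma continuous_pairr (S T : topologicalType) (s : S) :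
  continuous (fun t : T => (s, t)).
Proof.
by move=> t A [[B C] [/= Bs Ct] BCA]; apply: filterS Ct => t' Ct'; apply: BCA;
  split=> //=; exact: nbhs_singleton.
Qed.

(** A ball is star-shaped: it is the union of the segments joining [c] to its points, all of which
    contain [c]. *)
Lemma connected_ball (R : realType) (V : normedModType R) (c : V) (e : R) :
  connected (ball c e).
Proof.
have [e0|e0] := ltP 0 e; last first.
  suff -> : ball c e = set0 by exact: connected0.
  apply/seteqP; split=> // x /=; rewrite -ball_normE /= => h.
  by have := le_lt_trans (normr_ge0 _) (lt_le_trans h e0); rewrite ltxx.
pose seg p := (fun t : R => c + t *: (p - c)) @` `[0, 1].
have -> : ball c e = \bigcup_(p in ball c e) seg p.
  apply/seteqP; split=> [p cp|_ [p cp [t t01 <-]]].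
    exists p => //; exists 1; first by rewrite /= in_itv /= lexx ler01.
    by rewrite scale1r addrC subrK.
  move: cp t01; rewrite -ball_normE /= in_itv /= => cp /andP[t0 t1].
  rewrite opprD addNKr normrN normrZ (ger0_norm t0) distrC.
  by apply: le_lt_trans cp; rewrite ler_piMl.
apply: bigcup_connected.
  exists c => p _; exists 0; first by rewrite /= in_itv /= lexx ler01.
  by rewrite scale0r addr0.
move=> p _; apply: connected_continuous_connected; first exact: segment_connected.
apply: continuous_subspaceT => t.
by apply: cvgD; [exact: cvg_cst|apply: cvgZr_tmp; exact: cvg_id].
Qed.

Lemma locally_euclidean_locally_connected (R : realType) (d : nat)
    (T : topologicalType) (x : T) (A : set T) :
  locally_euclidean R d T -> nbhs x A ->
  exists C, [/\ nbhs x C, connected C & C `<=` A].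
Proof.
move=> /(_ x)[U [O [[oU Ux] oO [f [cf [g [fK gK cg]]]]]]] xA.
pose y : U := SigSub (mem_set Ux).
have : nbhs (f y) [set o | A (set_val (g o))].
  suff : nbhs (g (f y)) (set_val @^-1` A) by move=> /cg.
  by rewrite fK; exact: (@initial_continuous U T set_val y).
move=> /nbhs_set_typeP[N Nfy NA].
(* The ball is kept inside [O], so that no part of it is lost in the subtype and its connectedness
   passes to [B]. *)
have /nbhs_ballP[e /= e0 eON] : nbhs (set_val (f y)) (O `&` N).
  by apply: filterI => //; apply: open_nbhs_nbhs; split=> //; exact: set_valP.
pose B : set O := set_val @^-1` ball (set_val (f y)) e.
exists (set_val @` (f @^-1` B)); split.
- apply: (nbhs_image_open oU (x := y)); apply: cf.
  apply/nbhs_set_typeP; exists (ball (set_val (f y)) e) => //.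
  exact: nbhsx_ballx.
- have -> : f @^-1` B = g @` B.
    apply/seteqP; split=> [u Bu|_ [o Bo <-]]; last by rewrite /= gK.
    by exists (f u).
  have cB : connected B.
    apply: connected_set_type.
    suff -> : set_val @` B = ball (set_val (f y)) e by exact: connected_ball.
    apply/seteqP; split=> [_ [o Bo <-//]|p ep].
    by exists (SigSub (mem_set (eON _ ep).1)).
  apply: connected_continuous_connected; last first.
    by apply: continuous_subspaceT; exact: (@initial_continuous U T set_val).
  apply: connected_continuous_connected cB _.
  exact: continuous_subspaceT.
- move=> _ [u Bu <-]; rewrite -(fK u); apply: (NA (f u)).
  by have [] := eON _ Bu.
Qed.

(** * Points and neighbourhoods in the open cone *)

Section Cone.
Context {R : realType} {L : topologicalType}.
Local Notation cylinder := (L * (`[0%R, 1%R[%classic : set R))%type.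
Local Notation pi := (fun p : cylinder => \pi_(open_cone R L) p).

Lemma pi_cone_eq (p q : cylinder) : pi p = pi q ->
  p = q \/ set_val p.2 = 0 :> R /\ set_val q.2 = 0 :> R.
Proof. by move=> /eqmodP/orP[/eqP|/andP[/eqP ? /eqP ?]]; [left|right]. Qed.

Lemma cone_point_pi (p : cylinder) : cone_point (pi p) <-> set_val p.2 = 0 :> R.
Proof.
split=> [[q [q0 /pi_cone_eq[->//|[]//]]]|p0]; by exists p.
Qed.

(** Away from height 0 the classes of [cone_rel] are singletons, so the base coordinate can be read
    off the cone. *)
Lemma subcone_pi (A : set L) (p : cylinder) :
  set_val p.2 != 0 :> R -> subcone A (pi p) <-> A p.1.
Proof.
move=> /eqP p0; split=> [[/cone_point_pi//|[q [Aq /pi_cone_eq[->//|[]//]]]]|Ap].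
by right; exists p.
Qed.

Lemma pi_ray_continuous (l : L) :
  continuous (fun s : (`[0%R, 1%R[%classic : set R) => pi (l, s)).
Proof.
move=> s; apply: (continuous_comp (continuous_pairr (s := l) (x := s))).
exact: pi_continuous.
Qed.

(** For compact nonempty [L], the collars with [e > 0] form a neighbourhood basis of the cone
    point. *)
Definition collar (e : R) : set (open_cone R L) :=
  [set c | exists2 p : cylinder, set_val p.2 < e & c = pi p].

(** Only points of height 0 are identified, and they all have height below [e]; thus the condition
    is saturated. *)
Lemma pi_collar (e : R) (p : cylinder) :
  0 < e -> collar e (pi p) <-> set_val p.2 < e.
Proof.
move=> e0; split=> [[q qe /pi_cone_eq[->//|[-> _]//]]|pe]; by exists p.
Qed.

Lemma open_collar (e : R) : 0 < e -> open (collar e).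
Proof.
move=> e0; rewrite /open /= /quotient_open.
have -> : \pi_(open_cone R L) @^-1` collar e =
    (fun p : cylinder => set_val p.2) @^-1` [set t | t < e].
  by apply/seteqP; split=> p /pi_collar-/(_ e0).
apply: open_comp => [p _|]; last exact: open_lt.
apply: continuous_comp; first exact: cvg_snd.
exact: (@initial_continuous (`[0%R, 1%R[%classic : set R) _ set_val).
Qed.

(* By the tube lemma, whence the compactness of [L]. *)
Lemma collar_sub_nbhs (c : open_cone R L) (D : set (open_cone R L)) :
  compact [set: L] -> cone_point c -> nbhs c D ->
  exists2 e : R, 0 < e & collar e `<=` D.
Proof.
move=> cL c0; rewrite nbhsE => -[D' [oD' D'c] D'D].
have I0 : (`[0, 1[%classic : set R) 0 by rewrite /= in_itv /= lexx ltr01.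
pose z : (`[0%R, 1%R[%classic : set R) := SigSub (mem_set I0).
have : \forall t \near z, [set: L] `<=` [set l | D' (pi (l, t))].
  have /compact_near_coveringP/(_ _ (nbhs z)) tube := cL.
  apply: (tube (fun t l => D' (pi (l, t))) _) => l _.
  have : nbhs ((l, z) : cylinder) (\pi_(open_cone R L) @^-1` D').
    apply: open_nbhs_nbhs; split; first exact: oD'.
    have cE : c = pi (l, z).
      by apply: cone_point_unique => //; apply/cone_point_pi.
    by move: D'c; rewrite cE.
  by case=> PQ nPQ PQD; exists PQ => // -[l' t] /PQD.
move=> /nbhs_set_typeP[N /nbhs_ballP[e /= e0 eN] ND].
exists e => // _ [[l t] te ->]; apply: D'D; apply: (ND t) => //.
apply: eN; rewrite /= -ball_normE /= sub0r normrN ger0_norm //.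
by have := set_valP t; rewrite /= in_itv /= => /andP[].
Qed.

End Cone.

(** * Spreading a stratum closure through a conic chart *)

Lemma connected_open_segment (R : realType) (e : R) :
  connected [set s : (`[0%R, 1%R[%classic : set R) | 0 < set_val s < e].
Proof.
apply: connected_set_type; apply/connected_intervalP.
move=> _ _ [a /= /andP[a0 _] <-] [b /= /andP[_ be] <-] z /andP[az zb].
have := set_valP b; rewrite /= in_itv /= => /andP[_ b1].
have z0 := lt_le_trans a0 az.
have I_z : (`[0, 1[%classic : set R) z.
  by rewrite /= in_itv /= ltW //= (le_lt_trans zb).
by exists (SigSub (mem_set I_z)) => //=; rewrite z0 (le_lt_trans zb).
Qed.

(** This is the openness of the closure of a higher stratum inside the layer. Only points of the
    layer are reached, since near [x] they are the vertices of the cones in the chart. *)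
Lemma chart_closure_near (R : realType) (n i k : nat) (T : topologicalType)
    (X : nat -> set T) (x y0 : T) :
  filtered_space n X -> locally_euclidean R i (layer X i) ->
  conic_chart R n i X x -> layer X i x -> (i < k <= n)%N -> layer X k y0 ->
  closure (connected_component (layer X k) y0) x ->
  \forall z \near x, layer X i z ->
    closure (connected_component (layer X k) y0) z.
Proof.
move=> [Xcl Xmono _ _] lei [V [U [L [F [phi chart]]]]].
case: chart => -[oV Vx] [Ux [O oO /seteqP[UO OU]]] [cL [_ _ _ [l0 _]]].
move=> [cphi [psi [phiK psiK cpsi]]] [phi0 phiF] Xix /andP[ik kn] Xky0 xS.
set S := connected_component _ _ in xS *.
pose xU : U := SigSub (mem_set Ux).
have [th th0] := @cone_point_nonempty R L l0.
have phi_cone (u : U) c : cone_point c -> set_val (phi (u, c)) = set_val u.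
  exact: phi0.
have phix : set_val (phi (xU, th)) = x by rewrite phi_cone.
have phi_inj u c u' c' : set_val (phi (u, c)) = set_val (phi (u', c')) -> c = c'.
  by move=> /val_inj /(can_inj phiK) [_ ->].
(* Injectivity of [phi] turns the equality of images in the chart into a pointwise test that depends
   on the cone coordinate alone. *)
have phi_mem u c j : (j <= n - i.+1)%N ->
    X (i + j + 1)%N (set_val (phi (u, c))) <-> conic_filtration F j.+1 c.
  move=> jn; split=> [Xphi|Fc].
    have : (V `&` X (i + j + 1)%N) (set_val (phi (u, c))).
      by split=> //; exact: set_valP.
    by rewrite -phiF // => -[_ [[u' c'] [_ Fc'] <-] /phi_inj <-].
  suff : (V `&` X (i + j + 1)%N) (set_val (phi (u, c))) by case.
  by rewrite -phiF //; do 2 apply: imageP; split.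
have cvphi : continuous (fun q => set_val (phi q)).
  move=> q; apply: continuous_comp; first exact: cphi.
  exact: (@initial_continuous V T set_val).
(* A chart does not force [V `&` X i = U]; this holds after intersecting with
   [W], and keeps the rays over [F 0] out of [X i]. *)
pose W := O `&` ~` skel_pred X i.
have WU z : W z -> X i z -> U z by move=> [Oz nz] Xz; exact: OU.
have Ox : O x by have [] := UO _ Ux.
have layU (u : U) : layer X i (set_val u) by have [] := UO _ (set_valP u).
have nW : nbhs x W.
  apply: open_nbhs_nbhs; split; last by split=> //; case: Xix.
  apply: openI => //; apply: closed_openC.
  by case: (i) ik => [|i'] ik'; [exact: closed0|apply: Xcl; lia].
have [[A D] [/= Ax Dth] AD] : nbhs (xU, th) [set q | W (set_val (phi q))].
  by apply: cvphi; rewrite phix.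
have [N2 nN2 N2A] := (nbhs_set_typeP _ _).1 Ax.
have [e e0 eD] := collar_sub_nbhs cL th0 Dth.
pose xi : layer X i := SigSub (mem_set Xix).
(* Lying in [O] puts [C] inside [U], and lying in [N2] puts it inside [A]. *)
have [C [nC cC CO]] : exists C, [/\ nbhs xi C, connected C &
    C `<=` set_val @^-1` (O `&` N2)].
  apply: locally_euclidean_locally_connected lei _.
  apply: (@initial_continuous _ T set_val) => /=.
  by apply: filterI => //; exact: open_nbhs_nbhs.
have [N nN NC] := (nbhs_set_typeP _ _).1 nC.
(* The same set as [C], seen in the subspace [U] instead of the layer; connectedness is carried over
   through [T]. *)
pose C1 : set U := set_val @^-1` (set_val @` C).
have C1A : C1 `<=` A by move=> u [c /CO[_ N2c] cu]; apply: N2A; rewrite /= -cu.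
have cC1 : connected C1.
  apply: connected_set_type.
  have -> : set_val @` C1 = set_val @` C.
    apply/seteqP; split=> [_ [u Cu <-//]|_ [c Cc <-]].
    have Uc : U (set_val c).
      by apply: OU; split; [exact: set_valP|have [] := CO _ Cc].
    by exists (SigSub (mem_set Uc)) => //; exists c.
  apply: connected_continuous_connected cC _; apply: continuous_subspaceT.
  exact: (@initial_continuous _ T set_val).
have NC1 (u : U) : N (set_val u) -> C1 u.
  by move=> Nu; exists (SigSub (mem_set (layU u))) => //; exact: NC.
(* Since [V] is open, the product is a neighbourhood of [x] in [T], and so it meets [S]. *)
have : nbhs x (set_val @` (phi @` (C1 `*` collar e))).
  rewrite -phix; apply: nbhs_image_open => //.
  have -> : phi @` (C1 `*` collar e) = psi @^-1` (C1 `*` collar e).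
    apply/seteqP; split=> [_ [q Bq <-]|v Bv]; first by rewrite /= phiK.
    by exists (psi v).
  apply: cpsi; rewrite phiK; exists (C1, collar e) => //; split=> /=.
    by apply/nbhs_set_typeP; exists N.
  apply: open_nbhs_nbhs; split; first exact: open_collar.
  case: th0 => p [p0 ->]; apply/pi_collar => //.
  by rewrite p0.
move=> /xS[y [Sy [_ [[u c] [/= C1u [[l t] /= te ->]] <-] yE]]].
have Xky : layer X k y := connected_component_sub Sy.
(* With [j = k - i - 1], the step [X k] corresponds to the cone on [F j]. *)
have kE : k = (i + (k - i.+1) + 1)%N by lia.
move: (k - i.+1)%N kE => j kE.
have jn : (j <= n - i.+1)%N by lia.
(* At height 0 the point [y] would be [u], which lies in [X i] and hence in [X (k - 1)]. *)
have t0 : set_val t != 0 :> R.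
  apply/eqP => t0; case: Xky => _; apply.
  rewrite kE addn1 /= -yE phi_cone; last exact/cone_point_pi.
  have [Xu _] := layU u.
  by apply: Xmono Xu; lia.
have Fjl : F j l.
  have := (phi_mem u (\pi_(open_cone R L) (l, t)) _ jn).1.
  rewrite yE -kE => /(_ Xky.1).
  by move=> /subcone_pi; exact.
have layk u' (s : (`[0%R, 1%R[%classic : set R)) : C1 u' -> 0 < set_val s < e ->
    layer X k (set_val (phi (u', \pi_(open_cone R L) (l, s)))).
  move=> C1u' /andP[/lt0r_neq0 s0 se]; split.
    by rewrite kE; apply/phi_mem => //; apply/subcone_pi.
  (* It remains to avoid [X (k - 1)]. For [j = 0] this is [X i], outside the range of [phi_mem]:
     here [W] forces the point into [U], hence to the cone point. Otherwise [phi_mem] transfers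
     membership to [y], which is not in [X (k - 1)]. *)
  rewrite kE addn1 /=; case: j kE jn {Fjl} => [|j] kE jn Xs.
    move: Xs; rewrite addn0 => Xs.
    have Uz : U (set_val (phi (u', \pi_(open_cone R L) (l, s)))).
      apply: WU => //; apply: (AD (u', _)); split=> /=; first exact: C1A.
      by apply: eD; exists (l, s).
    have := phi_cone (SigSub (mem_set Uz)) th th0.
    move=> /phi_inj thE; move: th0; rewrite thE => /cone_point_pi.
    by move/eqP: s0.
  case: Xky => _; apply; rewrite kE addn1 /=.
  move: Xs; rewrite -yE addnS -addn1.
  move=> /phi_mem-/(_ _)/subcone_pi Fjl; apply/phi_mem; first by lia.
  by apply/subcone_pi => //; apply: Fjl => //; lia.
have SE : S = connected_component (layer X k) y.
  exact: same_connected_component.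
(* At the fixed height [t], the image of the connected set [C1] stays in [layer X k] and contains
   [y]. *)
have slice u' : C1 u' -> S (set_val (phi (u', \pi_(open_cone R L) (l, t)))).
  move=> C1u'; rewrite SE.
  pose f u' := set_val (phi (u', \pi_(open_cone R L) (l, t))).
  apply: (@connected_component_max _ _ (f @` C1)); last exact: imageP.
  - by exists u.
  - move=> _ [v C1v <-]; apply: layk => //; rewrite te andbT lt0r t0.
    by have := set_valP t; rewrite /= in_itv /= => /andP[].
  - apply: connected_continuous_connected cC1 _.
    apply: continuous_subspaceT => v.
    exact: (continuous_comp (continuous_pairl (x := v)) (cvphi _)).
have cray u' : continuous (fun s : (`[0%R, 1%R[%classic : set R) =>
    set_val (phi (u', \pi_(open_cone R L) (l, s)))).
  have cu' : continuous (fun d : open_cone R L => set_val (phi (u', d))).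
    by move=> d; exact: (continuous_comp (@continuous_pairr _ _ u' d) (cvphi _)).
  move=> s.
  exact: (continuous_comp (@pi_ray_continuous R L l s) (cu' _)).
have t01 : 0 < set_val t < 1.
  have := set_valP t; rewrite /= in_itv /= => /andP[tge0 ->].
  by rewrite lt0r t0 tge0.
(* From its point at height [t], each ray stays in [S] over all heights in []0, e[]. *)
have ray u' (s : (`[0%R, 1%R[%classic : set R)) : C1 u' -> 0 < set_val s < e ->
    S (set_val (phi (u', \pi_(open_cone R L) (l, s)))).
  move=> C1u' se; have -> : S = _ := same_connected_component (slice _ C1u').
  pose f s := set_val (phi (u', \pi_(open_cone R L) (l, s))).
  apply: (@connected_component_max _ _
    (f @` [set s | 0 < set_val s < e])); last exact: imageP.
  - by exists t => //=; rewrite te andbT; case/andP: t01.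
  - by move=> _ [s' se' <-]; exact: layk.
  - apply: connected_continuous_connected; first exact: connected_open_segment.
    apply: continuous_subspaceT; exact: cray.
(* A point [z] of the layer near [x] is the vertex of its own ray over [l], so any neighbourhood [B]
   of [z] contains points of that ray at small positive heights. *)
apply: filterS (filterI nN (open_nbhs_nbhs (conj oO Ox))) => z [Nz Oz] Xz B Bz.
have Uz : U z by exact: OU.
pose zU : U := SigSub (mem_set Uz).
have I0 : (`[0, 1[%classic : set R) 0 by rewrite /= in_itv /= lexx ltr01.
pose o : (`[0%R, 1%R[%classic : set R) := SigSub (mem_set I0).
have : nbhs o [set s | B (set_val (phi (zU, \pi_(open_cone R L) (l, s))))].
  by apply: cray; rewrite phi_cone //; exact/cone_point_pi.
move=> /nbhs_set_typeP[M /nbhs_ballP[r /= r0 rM] MB].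
case/andP: t01 => tgt0 t1.
(* Below [r], to land in [B], and at most [t], to remain below both [e] and 1. *)
pose s := Num.min (r / 2) (set_val t).
have s0 : 0 < s by rewrite lt_min divr_gt0.
have st : s <= set_val t by rewrite ge_min lexx orbT.
have I_s : (`[0, 1[%classic : set R) s.
  by rewrite /= in_itv /= ltW //= (le_lt_trans st).
pose s' : (`[0%R, 1%R[%classic : set R) := SigSub (mem_set I_s).
exists (set_val (phi (zU, \pi_(open_cone R L) (l, s')))); split.
  by apply: ray; [exact: NC1|rewrite /= s0 (le_lt_trans st)].
apply: (MB s'); apply: rM; rewrite /= -ball_normE /= sub0r normrN gtr0_norm //.
by rewrite gt_min ltr_pdivrMr // ltr_pMr // ltr1n.
Qed.

(** * The frontier condition, by comparing the dimensions of the two strata *)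

Theorem theorem7 (R : realType) (n : nat) (T : topologicalType)
    (X : nat -> set T) : CS_set R n X -> stratified_space n X.
Proof.
move=> [fX manX chartX]; split=> // S S' [i [x0 [ilen Xx0 SE]]].
move=> [k [y0 [kn Xy0 S'E]]] [x [Sx S'x]].
have Xx : layer X i x by apply: (@connected_component_sub _ _ x0); rewrite -SE.
have [Xcl Xmono _ _] := fX.
have S'X : S' `<=` layer X k by rewrite S'E; exact: connected_component_sub.
have S'Xk z : closure S' z -> X k z.
  move=> S'z; rewrite (closure_id (X k)).1; last exact: Xcl.
  by apply: closureS S'z => w /S'X[].
have [ki|ik|ki] := ltngtP k i.
(* If [k < i], the closed set [X k] contains [closure S'], so [x] would lie in [X (i - 1)]. *)
- case: Xx => _ nXx; exfalso; apply: nXx.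
  by case: i ki ilen {SE Xx0} => // i ki ilen; apply: Xmono (S'Xk _ S'x); lia.
(* If [i < k], local openness makes the trace of [closure S'] on the connected set [S] clopen, and
   [x] makes it nonempty. *)
- suff cS z : S z -> closure S' z -> \forall w \near z, S w -> closure S' w.
    have cS0 : connected S by rewrite SE; exact: component_connected.
    suff <- : S `&` closure S' = S by move=> w [].
    apply: cS0; first by exists x.
      exists (interior [set w | S w -> closure S' w]); first exact: open_interior.
      apply/seteqP; split=> w [Sw wS']; split=> //; first exact: cS.
      exact: (interior_subset wS').
    by exists (closure S') => //; exact: closed_closure.
  move=> Sz S'z.
  have Xz : layer X i z by apply: (@connected_component_sub _ _ x0); rewrite -SE.
  have [X0|[_ lei]] := manX _ ilen; first by rewrite X0 in Xz.
  have iltn : (i < n)%N by exact: leq_trans kn.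
  have := chart_closure_near fX lei (chartX _ _ iltn Xz) Xz _ Xy0.
  rewrite -S'E ik kn => /(_ isT S'z); apply: filterS => w wS' Sw; apply: wS'.
  by apply: (@connected_component_sub _ _ x0); rewrite -SE.
(* If [k = i], adding the limit point [x] to [S'] keeps it connected and inside the layer, so the
   component already contains [x]. *)
- have S'_x : S' x.
    rewrite S'E; exists (S' `|` [set x]); last by right.
    split; first by left; rewrite S'E; exact: connected_component_refl.
      by move=> w [/S'X//|->]; rewrite ki.
    apply: (connected_between (A := S')).
    - by rewrite S'E; exact: component_connected.
    - by move=> w; left.
    - by move=> w [/subset_closure//|->].
  suff -> : S = S' by exact: subset_closure.
  rewrite SE S'E -ki in Sx S'_x *.
  rewrite (same_connected_component Sx).
  by rewrite (same_connected_component S'_x).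
Qed.
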